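(* Let $\mathcal{K}\subset\mathbb{R}^n$ be a compact basic semialgebraic set with nonempty interior, and let $\mathcal{B}=\mathcal{B}_1\times\cdots\times\mathcal{B}_n\supseteq\mathcal{K}$ be a compact semialgebraic set that is a cartesian product of $n$ one-dimensional sets. For each integer $d>0$, let $\gamma_d$ be the acceptance rate of the sampling algorithm described in the context (Algorithm 1) run with the degree-$d$ polynomial approximation $p_d^*$ of the indicator function of $\mathcal{K}$. Then the acceptance rate tends to one as the degree $d$ increases: $$\lim_{d\to\infty}\gamma_d=1.$$
   Context: $\mathcal{K}=\{x\in\mathbb{R}^n : g_i(x)\ge 0,\ i=1,\dots,m\}$ with given real multivariate polynomials $g_1,\dots,g_m$. $\mathcal{P}_d$ is the vector space of real polynomials in $n$ variables of degree at most $d$. The polynomial approximation $p_d^*$ is an optimal solution of $$w_d^*:=\min_{p\in\mathcal{P}_d}\int_{\mathcal{B}}p(x)\,dx\quad\text{s.t.}\quad p\ge 1\text{ on }\mathcal{K},\quad p\ge 0\text{ on }\mathcal{B}.$$ Algorithm 1: 1. For the given integer $d>0$, compute an optimal solution $p_d^*$ of the problem of minimizing $\int_{\mathcal{B}}p(x)\,dx$ over $p\in\mathcal{P}_d$ subject to $p\ge 1$ on $\mathcal{K}$ and $p\ge 0$ on $\mathcal{B}$. 2. Generate a random sample $\xi$ with density proportional to $p_d^*$ over $\mathcal{B}$. 3. If $\xi\notin\mathcal{K}$, restart with a new sample (go to step 2). 4. Generate a sample $u$ uniform on $[0,1]$. 5. If $u\,p_d^*(\xi)\le 1$, return $x=\xi$;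 otherwise restart with a new sample (go to step 2). All random draws (the successive samples $\xi$ and $u$) are mutually independent. The acceptance rate $\gamma_d$ of the algorithm is defined as one over the expected number of samples that have to be drawn from the density proportional to $p_d^*$ (step 2) in order to obtain one accepted (returned) sample. *)

(* Defs.v *)
From HB Require Import structures.
From mathcomp Require Import all_boot all_order all_algebra.
From mathcomp Require Import finmap.
(* Some notations of mpoly clash with those of the analysis library, and some of
   its names (e.g. isMeasure) must be shadowed by it. *)
From mathcomp.multinomials Require Import -(notations) mpoly.
From mathcomp Require Import all_classical all_reals all_analysis.
Set Implicit Arguments.
Unset Strict Implicit.
Unset Printing Implicit Defensive.
Import Order.TTheory GRing.Theory Num.Theory.
Import numFieldNormedType.Exports.
Local Open Scope classical_set_scope.
Local Open Scope ring_scope.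
Local Open Scope ereal_scope.

(* Points of R^n are tuples, on which the library puts the product
   sigma-algebra.  The library has no topology on tuples, so topological notions
   go through the row vector with the same coordinates. *)
Definition rV_of_tuple (R : realType) (n : nat) (x : n.-tuple R) : 'rV[R]_n :=
  \row_i tnth x i.

Definition compact_Rn (R : realType) (n : nat) (A : set (n.-tuple R)) : Prop :=
  compact (@rV_of_tuple R n @` A).

Definition interior_Rn (R : realType) (n : nat) (A : set (n.-tuple R)) :
    set (n.-tuple R) :=
  [set x | (interior (@rV_of_tuple R n @` A)) (rV_of_tuple x)].

Section lebesgue_Rn_succ.
Variables (R : realType) (n : nat).
Variable mu : {sigma_finite_measure set (n.-tuple R) -> \bar R}.

Definition tuple_of_pair (z : measurableTypeR R * n.-tuple R) : n.+1.-tuple R :=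
  [tuple of z.1 :: z.2].

Lemma measurable_tuple_of_pair : measurable_fun setT tuple_of_pair.
Proof. by apply: measurable_cons; [exact: measurable_fst|exact: measurable_snd]. Qed.

Definition lebesgue_Rn_succ : set (n.+1.-tuple R) -> \bar R :=
  pushforward (@lebesgue_measure R \x mu) tuple_of_pair.

Let lebS0 : lebesgue_Rn_succ set0 = 0.
Proof. by rewrite /lebesgue_Rn_succ /pushforward preimage_set0 measure0. Qed.

Let lebS_ge0 A : 0 <= lebesgue_Rn_succ A.
Proof. exact: (measure_ge0 (@lebesgue_measure R \x mu)). Qed.

Let lebS_sigma_additive : semi_sigma_additive lebesgue_Rn_succ.
Proof.
move=> F mF tF mUF; rewrite /lebesgue_Rn_succ /pushforward preimage_bigcup.
have mpre (B : set (n.+1.-tuple R)) : measurable B ->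
    measurable (tuple_of_pair @^-1` B).
  by move=> mB; rewrite -[X in measurable X]setTI; exact: measurable_tuple_of_pair.
apply: measure_semi_sigma_additive.
- by move=> k; exact: mpre.
- apply/trivIsetP => /= i j _ _ ij; rewrite -preimage_setI.
  by move/trivIsetP : tF => /(_ _ _ _ _ ij) ->//; rewrite preimage_set0.
- by rewrite -preimage_bigcup; exact: mpre.
Qed.

HB.instance Definition _ := isMeasure.Build _ _ _ lebesgue_Rn_succ
  lebS0 lebS_ge0 lebS_sigma_additive.

Let pair_of_tuple (x : n.+1.-tuple R) : measurableTypeR R * n.-tuple R :=
  (thead x, [tuple of behead x]).

Let lebS_sigma_finite : sigma_finite setT lebesgue_Rn_succ.
Proof.
have /sigma_finiteP[F [TF ndF Foo]] := sigma_finiteT (@lebesgue_measure R).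
have /sigma_finiteP[G [TG ndG Goo]] := sigma_finiteT mu.
have mpair : measurable_fun setT pair_of_tuple.
  apply/measurable_fun_pairP; split => /=.
    exact: (measurable_tnth (@ord0 n)).
  exact: measurable_behead.
exists (fun k => pair_of_tuple @^-1` (F k `*` G k)).
  rewrite -preimage_bigcup; apply/esym/seteqP; split=> // x _.
  have [i _ Fi] : (\bigcup_i F i) (pair_of_tuple x).1 by rewrite -TF.
  have [j _ Gj] : (\bigcup_i G i) (pair_of_tuple x).2 by rewrite -TG.
  exists (maxn i j) => //; split.
  - by move: Fi; exact/subsetPset/ndF/leq_maxl.
  - by move: Gj; exact/subsetPset/ndG/leq_maxr.
move=> k; have [mF Fk] := Foo k; have [mG Gk] := Goo k; split.
  by rewrite -[X in measurable X]setTI; apply: mpair => //; exact: measurableX.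
rewrite /lebesgue_Rn_succ /pushforward -comp_preimage.
rewrite (_ : pair_of_tuple \o tuple_of_pair = id); last first.
  by apply/funext => -[a t]; rewrite /pair_of_tuple /=; congr pair; exact: val_inj.
by rewrite preimage_id product_measure1E// lte_mul_pinfty// ge0_fin_numE.
Qed.

HB.instance Definition _ := Measure_isSigmaFinite.Build _ _ _ lebesgue_Rn_succ
  lebS_sigma_finite.

End lebesgue_Rn_succ.

Fixpoint lebesgue_Rn (R : realType) (n : nat) :
    {sigma_finite_measure set (n.-tuple R) -> \bar R} :=
  match n with
  | 0%N => \d_[tuple]
  | k.+1 => lebesgue_Rn_succ (lebesgue_Rn R k)
  end.

Definition box (R : realType) (n : nat) (B : 'I_n -> set R) :
    set (n.-tuple R) :=
  [set x | forall i, B i (tnth x i)].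

Lemma measurable_box (R : realType) (n : nat) (B : 'I_n -> set R) :
  (forall i, measurable (B i)) -> measurable (box B).
Proof.
move=> mB.
have -> : box B = \bigcap_(i in [set: 'I_n]) ((fun x => @tnth n R x i) @^-1` B i).
  by apply/seteqP; split => x /= xB i; [move=> _|]; exact: xB.
apply: fin_bigcap_measurable => // i _; rewrite -[X in measurable X]setTI.
exact: measurable_tnth.
Qed.

(* Characterizes lebesgue_Rn as n-dimensional Lebesgue measure. *)
Lemma lebesgue_Rn_box (R : realType) (n : nat) (B : 'I_n -> set R) :
  (forall i, measurable (B i)) ->
  lebesgue_Rn R n (box B) = \prod_(i < n) lebesgue_measure (B i).
Proof.
elim: n B => [|n IHn] B mB.
  rewrite big_ord0 /= diracE mem_set//; by case.
rewrite big_ord_recl /= /lebesgue_Rn_succ /pushforward.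
have -> : @tuple_of_pair R n @^-1` box B =
    B ord0 `*` box (fun i => B (lift ord0 i)).
  apply/seteqP; split => -[a t] /=.
    move=> H; split; first exact: (H ord0).
    by move=> i; have := H (lift ord0 i); rewrite tnthS.
  move=> [/= Ba Ht] i; case: (unliftP ord0 i) => [j ->|->//].
  by rewrite tnthS; exact: Ht.
rewrite product_measure1E//; [|exact: mB|exact: measurable_box].
by rewrite IHn.
Qed.

Definition peval (R : realType) (n : nat) (p : mpoly.mpoly n R)
    (x : n.-tuple R) : R :=
  mpoly.meval (tnth x) p.

Definition basic_closed_semialgebraic (R : realType) (n m : nat)
    (g : 'I_m -> mpoly.mpoly n R) : set (n.-tuple R) :=
  [set x | forall i, (0 <= peval (g i) x)%R].

(* Finite unions of sets {f_1 = ... = f_r = 0, h_1 > 0, ..., h_s > 0}. *)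
Definition semialgebraic (R : realType) (n : nat) (A : set (n.-tuple R)) :
    Prop :=
  exists s : seq (seq (mpoly.mpoly n R) * seq (mpoly.mpoly n R)),
    A = [set x | exists2 c, c \in s &
           (forall f, f \in c.1 -> peval f x = 0%R) /\
           (forall h, h \in c.2 -> (0 < peval h x)%R)].

Section approximation.
Variables (R : realType) (n : nat) (K B : set (n.-tuple R)) (d : nat).

(* msize is one plus the total degree, and 0 on the zero polynomial. *)
Definition feasible (p : mpoly.mpoly n R) : Prop :=
  [/\ (mpoly.msize p <= d.+1)%N,
      forall x, K x -> (1 <= peval p x)%R &
      forall x, B x -> (0 <= peval p x)%R].

Definition optimal (p : mpoly.mpoly n R) : Prop :=
  feasible p /\ forall q, feasible q ->
    \int[lebesgue_Rn R n]_(x in B) (peval p x)%:E <=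
    \int[lebesgue_Rn R n]_(x in B) (peval q x)%:E.

End approximation.

Definition density_proportional (R : realType) (n : nat)
    (dT : measure_display) (T : measurableType dT) (P : probability T R)
    (X : {RV P >-> n.-tuple R}) (B : set (n.-tuple R))
    (p : mpoly.mpoly n R) : Prop :=
  forall A, measurable A ->
    distribution P X A =
      (\int[lebesgue_Rn R n]_(x in A `&` B) (peval p x)%:E) /
      (\int[lebesgue_Rn R n]_(x in B) (peval p x)%:E).

Definition mutually_independent (R : realType) (dT : measure_display)
    (T : measurableType dT) (P : probability T R) (I : choiceType)
    (F : I -> set (set T)) : Prop :=
  forall (J : {fset I}) (A : I -> set T),
    (forall i, i \in J -> F i (A i)) ->
    P (\bigcap_(i in [set` J]) A i) = \prod_(i <- J) P (A i).

Section rejection_sampling.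
Variables (R : realType) (n : nat) (K B : set (n.-tuple R)).
Variable p : mpoly.mpoly n R.
Variables (dT : measure_display) (T : measurableType dT).
Variable P : probability T R.
(* xi k and u k are the samples of the k-th pass through the loop; u k is simply
   not looked at when xi k is outside K. *)
Variables (xi : nat -> {RV P >-> n.-tuple R}) (u : nat -> {RV P >-> R}).

Definition sampling_run : Prop :=
  [/\ forall k, density_proportional (xi k) B p,
      forall k A, measurable A ->
        distribution P (u k) A = uniform_prob (@ltr01 R) A &
      mutually_independent P (fun i : nat + nat =>
        match i with
        | inl k => g_sigma_algebra_preimage (xi k)
        | inr k => g_sigma_algebra_preimage (u k)
        end)].

Definition accepted (k : nat) (w : T) : Prop :=
  K (xi k w) /\ (u k w * peval p (xi k w) <= 1)%R.

(* Equal to +oo (infimum of the empty set) if no sample is ever accepted. *)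
Definition num_draws (w : T) : \bar R :=
  ereal_inf [set (k.+1)%:R%:E | k in [set k | accepted k w]].

Definition acceptance_rate : \bar R := (\int[P]_w num_draws w)^-1.

End rejection_sampling.

(* Main.v *)
Require Import Defs.
From mathcomp Require Import all_boot all_order all_algebra.
From mathcomp Require Import finmap ring lra.
From mathcomp.multinomials Require Import -(notations) mpoly.
From mathcomp Require Import all_classical all_reals all_analysis measurable_realfun.
Import Order.TTheory GRing.Theory Num.Theory.
Import numFieldNormedType.Exports.
Local Open Scope classical_set_scope.
Local Open Scope ring_scope.

(** One pass of the sampler accepts with probability vol K / w_d, where w_d is the
    integral of p_d over B, so the acceptance rate tends to 1 as soon as w_d tends
    to vol K.  Both halves of this are proved below as inequalities.

    The optimal values.  As p_d is at least 1 on K and nonnegative on B, w_d is at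
    least vol K.  Conversely [indicator_approximation] builds polynomials that are
    at least 1 on K, nonnegative on B, and whose integrals over B tend to vol K:
    K is cut out by the inequalities g i >= 0, so its indicator is a product of
    step functions of the g i, and explicit univariate polynomials [step] converge
    pointwise and boundedly to a step function.  Each of these polynomials is
    feasible once d exceeds its degree, whence [optimal_value_le].

    The sampler.  The rate is at most 1 because at least one sample is drawn.  For
    the lower bound fix e > 0, and take d so large that w_d <= vol K * (1 + e^2).
    Since p_d >= 1 on K, Markov's inequality ([measure_near1_ge]) shows that
    p_d <= 1 + e on a part K' of K of volume at least (1 - e) * vol K.  A pass with
    xi in K' and u <= 1 / (1 + e) is accepted.  This event has a probability q
    close to 1, and as it is a rectangle in (xi, u), mutual independence directly
    gives the probability (1 - q)^k that it fails in the first k passes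
    ([prob_no_joint_success]).  Summing over k, the expected number of draws is at
    most 1 / q ([acceptance_rate_ge]), so that the rate is at least q. *)

(** * Waiting time for the first success *)

Section waiting_time.
Context {R : realType} {dT : measure_display} {T : measurableType dT}.
Implicit Type A : nat -> set T.
Local Open Scope ereal_scope.

(** Tail-sum formula: the rank of the first success is the number of k such that
    the first k trials fail, k = 0 included.  When no trial succeeds both sides
    are infinite, the left one as the infimum of the empty set. *)
Lemma first_success_series A w :
  ereal_inf [set (k.+1)%:R%:E | k in [set k | A k w]] =
  \sum_(0 <= k <oo) (\1_(\bigcap_(j < k) ~` A j) w)%:E :> \bar R.
Proof.
have ge0 k : 0 <= (\1_(\bigcap_(j < k) ~` A j) w : R)%:E by rewrite lee_fin.
have [exA|noA] := pselect (exists k, A k w); last first.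
  rewrite (_ : [set k | A k w] = set0) ?image_set0 ?ereal_inf0; last first.
    by apply/seteqP; split=> // k Ak; apply: noA; exists k.
  apply/esym/eqyP => e e0.
  apply: le_trans (nneseries_lim_ge (Num.truncn e).+1 (fun k _ _ => ge0 k)).
  rewrite big_mkord (eq_bigr (fun=> 1)); last first.
    by move=> k _; rewrite indicE mem_set// => j _ Aj; apply: noA; exists j.
  by rewrite sumEFin sumr_const card_ord lee_fin ltW// truncnS_gt.
have exb : exists k, `[< A k w >] by case: exA => k Ak; exists k; exact/asboolP.
(* The terms of index at most the first success k are 1, the others are 0. *)
case: (ex_minnP exb) => k /asboolP Ak kmin.
rewrite (@nneseries_split _ _ 0 k.+1)// [X in _ + X]eseries0 ?adde0; last first.
  move=> j kj _; rewrite indicE memNset// => /(_ k kj); exact.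
rewrite add0n big_mkord (eq_bigr (fun=> 1)); last first.
  move=> j _; rewrite indicE mem_set// => i /= ij Ai.
  have := kmin i; rewrite asboolT// => /(_ isT).
  by rewrite leqNgt (leq_trans ij)// -ltnS.
rewrite sumEFin sumr_const card_ord.
apply/eqP; rewrite eq_le; apply/andP; split.
  by apply: ereal_inf_lbound; exists k.
apply: le_ereal_inf_tmp => _ [j /= Aj <-]; rewrite lee_fin ler_nat ltnS.
exact/kmin/asboolP.
Qed.

Lemma measurable_no_success A k : (forall j, measurable (A j)) ->
  measurable (\bigcap_(j < k) ~` A j).
Proof.
move=> mA; apply: fin_bigcap_measurable => [|j _]; first exact: finite_II.
exact: measurableC.
Qed.

Lemma integral_first_success (P : probability T R) A :
  (forall k, measurable (A k)) ->
  \int[P]_w ereal_inf [set (k.+1)%:R%:E | k in [set k | A k w]] =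
  \sum_(0 <= k <oo) P (\bigcap_(j < k) ~` A j).
Proof.
move=> mA; under eq_integral do rewrite first_success_series.
rewrite integral_nneseries//=.
- apply: eq_eseriesr => k _; rewrite integral_indic// ?setIT//.
  exact: measurable_no_success.
- move=> k; apply/measurable_EFinP; apply: measurable_indic.
  exact: measurable_no_success.
Qed.

(** Independence is only assumed for finite intersections of the Z i.  It passes
    to the failures Z (inl j) `&` Z (inr j) one index j at a time, by writing a
    failure as a difference. *)
Lemma prob_no_joint_success (P : probability T R) (Z : nat + nat -> set T) (a b : R) :
  (forall i, measurable (Z i)) ->
  (forall J : {fset nat + nat},
     P (\bigcap_(i in [set` J]) Z i) = \prod_(i <- J) P (Z i)) ->
  (forall k, P (Z (inl k)) = a%:E) -> (forall k, P (Z (inr k)) = b%:E) ->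
  forall k, P (\bigcap_(j < k) ~` (Z (inl j) `&` Z (inr j))) =
    ((1 - a * b) ^+ k)%:E.
Proof.
move=> mZ indZ Pa Pb.
pose idx (i : nat + nat) := match i with inl j => j | inr j => j end.
pose W k := \bigcap_(j < k) ~` (Z (inl j) `&` Z (inr j)).
have mW k : measurable (W k).
  by apply: measurable_no_success => j; exact: measurableI.
have mJ (J : {fset nat + nat}) : measurable (\bigcap_(i in [set` J]) Z i).
  by apply: fin_bigcap_measurable => //; exact: finite_fset.
(* The induction on k needs the events that come after the first k pairs. *)
suff H k (J : {fset nat + nat}) : (forall i, i \in J -> (k <= idx i)%N) ->
    P (W k `&` \bigcap_(i in [set` J]) Z i) =
    ((1 - a * b) ^+ k)%:E * \prod_(i <- J) P (Z i).
  move=> k; have := H k fset0; rewrite set_fset0 bigcap_set0 setIT => -> //.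
  by rewrite big_seq_fset0 mule1.
elim: k J => [|k IH] J Jk.
  by rewrite /W bigcap_mkord big_ord0 setTI expr0 mul1e.
(* One more failure removes the part where the pair of index k occurs. *)
pose J' := (inl k |` (inr k |` J))%fset.
have kJ : inr k \notin J by apply/negP => /Jk; rewrite /= ltnn.
have kJ' : inl k \notin (inr k |` J)%fset.
  by rewrite !inE /=; apply/negP => /Jk; rewrite /= ltnn.
have prodJ' : \prod_(i <- J') P (Z i) = (a * b)%:E * \prod_(i <- J) P (Z i).
  by rewrite !big_fsetU1//= Pa Pb muleA EFinM.
have J'k i : i \in J' -> (k <= idx i)%N.
  by rewrite !inE => /or3P[/eqP->//|/eqP->//|/Jk/ltnW].
have -> : W k.+1 `&` \bigcap_(i in [set` J]) Z i =
    (W k `&` \bigcap_(i in [set` J]) Z i) `\` (Z (inl k) `&` Z (inr k)).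
  by rewrite /W !bigcap_mkord big_ord_recr /= setDE setIAC.
rewrite measureD; [|exact: measurableI|exact: measurableI|]; last first.
  by rewrite (le_lt_trans (probability_le1 _ _)) ?ltry//; exact: measurableI.
rewrite -setIA (setIC (\bigcap_(i in [set` J]) Z i)) -setIA.
have -> : Z (inl k) `&` (Z (inr k) `&` \bigcap_(i in [set` J]) Z i) =
    \bigcap_(i in [set` J']) Z i by rewrite !bigcap_fsetU1.
have Jk' i : i \in J -> (k <= idx i)%N by move=> /Jk/ltnW.
apply: etrans (congr2 (fun x y => x - y) (IH J Jk') (IH J' J'k)) _ => /=.
rewrite prodJ' -indZ.
rewrite -(@fineK _ (P (\bigcap_(i in [set` J]) Z i)))//; last by rewrite fin_num_measure.
rewrite -!EFinM -EFinB; congr _%:E; rewrite exprSr; ring.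
Qed.

Lemma nneseries_geometric (z : R) : (0 <= z < 1)%R ->
  \sum_(0 <= k <oo) (z ^+ k)%:E = ((1 - z)^-1)%:E.
Proof.
move=> /andP[z0 z1]; apply/cvg_lim => //.
have h := @cvg_geometric_series R 1 z; rewrite ger0_norm// mul1r in h.
apply: cvg_EFin; first by apply: nearW => k; rewrite sumEFin.
apply: cvg_trans (h z1); apply: near_eq_cvg; near=> k.
by rewrite /= sumEFin /=; apply: eq_bigr => i _; rewrite /geometric/= mul1r.
Unshelve. all: by end_near. Qed.

End waiting_time.

(** * Measurability and volume of semialgebraic sets *)

Lemma measurable_sublevel {d : measure_display} {T : measurableType d}
    {R : realType} (f : T -> R) (a : R) :
  measurable_fun setT f -> measurable [set x | f x <= a].
Proof.
move=> mf; rewrite (_ : mkset _ = f @^-1` `]-oo, a]).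
  by rewrite -[X in measurable X]setTI; exact: mf.
by apply/seteqP; split => x; rewrite /= in_itv.
Qed.

Lemma measurable_peval {R : realType} {n : nat} (q : mpoly.mpoly n R) :
  measurable_fun setT (peval q).
Proof.
rewrite /peval (_ : (fun x => _) = fun x : n.-tuple R =>
    \sum_(a <- msupp q) mcoeff a q * \prod_i tnth x i ^+ a i); last first.
  by apply/funext => x; rewrite mevalE.
apply: measurable_sum => a; apply: measurable_funM => //.
by apply: measurable_prod => i _; apply: measurable_funX; exact: measurable_tnth.
Qed.

Lemma measurable_semialgebraic {R : realType} {n : nat} (A : set (n.-tuple R)) :
  semialgebraic A -> measurable A.
Proof.
move=> [s ->].
rewrite (_ : [set x | _] = \bigcup_(c in [set` s])
   ((\bigcap_(f in [set` c.1]) (peval f @^-1` [set 0])) `&`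
    (\bigcap_(h in [set` c.2]) (peval h @^-1` `]0, +oo[))) :> set (n.-tuple R));
  last first.
  apply/seteqP; split => x [c cs [c1 c2]]; exists c => //; split => //= h hc.
    by rewrite /= in_itv/= andbT; exact: c2.
  by have := c2 h hc; rewrite /= in_itv/= andbT.
apply: fin_bigcup_measurable => [|c _]; [exact: finite_seq|apply: measurableI].
  apply: fin_bigcap_measurable => [|f _]; first exact: finite_seq.
  by rewrite -[X in measurable X]setTI; exact: measurable_peval.
apply: fin_bigcap_measurable => [|f _]; first exact: finite_seq.
by rewrite -[X in measurable X]setTI; exact: measurable_peval.
Qed.

Lemma measurable_basic_closed {R : realType} {n m : nat}
    (g : 'I_m -> mpoly.mpoly n R) : measurable (basic_closed_semialgebraic g).
Proof.
rewrite (_ : basic_closed_semialgebraic g =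
    \bigcap_(i in [set: 'I_m]) (peval (g i) @^-1` `[0, +oo[)); last first.
  apply/seteqP; split => x gx i; first by move=> _; rewrite /= in_itv/= andbT; exact: gx.
  by have := gx i I; rewrite /= in_itv/= andbT.
apply: fin_bigcap_measurable => // i _; rewrite -[X in measurable X]setTI.
exact: measurable_peval.
Qed.

Lemma compact_Rn_bounded {R : realType} {n : nat} (A : set (n.-tuple R)) :
  compact_Rn A -> exists2 M : R, 0 <= M & forall x, A x -> forall i, `|tnth x i| <= M.
Proof.
move=> /compact_bounded[N [_ /(_ (`|N| + 1))]].
have NN : N < `|N| + 1 by rewrite (le_lt_trans (ler_norm N))// ltrDl.
move=> /(_ NN) bA.
exists (`|N| + 1) => [|x Ax i]; first by rewrite addr_ge0.
have /= := bA (rV_of_tuple x) (ex_intro2 _ _ x Ax erefl).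
apply: le_trans; rewrite [leRHS]/Num.norm/= mx_normrE.
by apply/bigmax_geP; right; exists (ord0, i) => //=; rewrite mxE.
Qed.

Lemma peval_bounded {R : realType} {n : nat} (A : set (n.-tuple R))
    (q : mpoly.mpoly n R) : compact_Rn A ->
  exists2 M : R, 0 < M & forall x, A x -> `|peval q x| <= M.
Proof.
move=> /compact_Rn_bounded[N N0 AN].
pose M := \sum_(a <- msupp q) `|mcoeff a q| * \prod_(i < n) N ^+ a i.
have M0 : 0 <= M.
  by apply: sumr_ge0 => a _; rewrite mulr_ge0// prodr_ge0// => i _; exact: exprn_ge0.
exists (M + 1) => [|x Ax]; first by rewrite ltr_wpDl.
rewrite /peval mevalE (le_trans (ler_norm_sum _ _ _))// (@le_trans _ _ M)//; last first.
  by rewrite lerDl.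
apply: ler_sum => a _; rewrite normrM ler_wpM2l// normr_prod.
apply: ler_prod => i _; rewrite normr_ge0 normrX/=.
by rewrite lerXn2r ?nnegrE//; exact: AN.
Qed.

Lemma lebesgue_Rn_compact_lty {R : realType} {n : nat} (A : set (n.-tuple R)) :
  measurable A -> compact_Rn A -> (lebesgue_Rn R n A < +oo)%E.
Proof.
move=> mA /compact_Rn_bounded[N N0 AN].
have mI (i : 'I_n) : measurable (`[- N, N]%classic : set R) by [].
rewrite (@le_lt_trans _ _ (lebesgue_Rn R n (box (fun=> `[- N, N]%classic))))//.
  apply: le_measure; rewrite ?inE//; first exact: measurable_box.
  by move=> x Ax i; rewrite /= in_itv/= -ler_norml; exact: AN.
rewrite lebesgue_Rn_box// (eq_bigr (fun=> (N + N)%:E)); last first.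
  move=> i _; rewrite lebesgue_measure_itv/= lte_fin -EFinD opprK.
  case: ltP => // NN; congr _%:E; lra.
by rewrite prodEFin ltry.
Qed.

Lemma lebesgue_Rn_interior_gt0 {R : realType} {n : nat} (A : set (n.-tuple R)) :
  measurable A -> interior_Rn A !=set0 -> (0 < lebesgue_Rn R n A)%E.
Proof.
move=> mA [x]; rewrite /interior_Rn/= /interior => /nbhs_ballP[e/= e0 xA].
pose I (i : 'I_n) : set R := `]tnth x i - e, tnth x i + e[%classic.
have mI i : measurable (I i) by exact: measurable_itv.
rewrite (@lt_le_trans _ _ (lebesgue_Rn R n (box I)))//; last first.
  apply: le_measure; rewrite ?inE//; first exact: measurable_box.
  move=> y Iy; have [|z Az zy] := xA (rV_of_tuple y).
    split => // i j; rewrite !mxE /ball/=.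
    by move: (Iy j); rewrite /I/= in_itv/= => yj; rewrite ltr_distlC.
  suff -> : y = z by [].
  apply: eq_from_tnth => i; have := congr1 (fun v : 'rV_n => v ord0 i) zy.
  by rewrite !mxE.
rewrite lebesgue_Rn_box// (eq_bigr (fun=> (e + e)%:E)); last first.
  move=> i _; rewrite lebesgue_measure_itv/= lte_fin -EFinD.
  case: ltP => NN; [congr _%:E; lra|by exfalso; lra].
rewrite prodEFin lte_fin prodr_gt0// => *; lra.
Qed.

(** * Polynomials close to a step function *)

Section step.
Context {R : realType}.
Implicit Types (x t : R) (N l : nat).

Lemma bernoulli_ge x N : x <= 1 -> 1 - N%:R * x <= (1 - x) ^+ N.
Proof.
move=> x1; elim: N => [|N IH]; first by rewrite mul0r subr0 expr0.
have x1' : 0 <= 1 - x by rewrite subr_ge0.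
rewrite exprS; apply: le_trans (ler_wpM2l x1' IH).
rewrite -natr1; have : 0 <= N%:R * x ^+ 2 by rewrite mulr_ge0// sqr_ge0.
rewrite expr2; lra.
Qed.

(** By Bernoulli's inequality 1 + N x is at most (1 + x) ^+ N, so the product is at
    most (1 - x ^+ 2) ^+ N. *)
Lemma bernoulli_le x N : 0 <= x <= 1 -> (1 - x) ^+ N * (1 + N%:R * x) <= 1.
Proof.
move=> /andP[x0 x1]; elim: N => [|N IH]; first by rewrite mul0r addr0 expr0 mulr1.
apply: le_trans IH; rewrite exprSr -mulrA ler_wpM2l ?exprn_ge0 ?subr_ge0//.
rewrite -natr1; have : 0 <= (N%:R + 1) * x ^+ 2 by rewrite mulr_ge0// sqr_ge0.
rewrite expr2; lra.
Qed.

(** The power (1 - t ^+ a) ^+ N drops from about 1 to about 0 where N * t ^+ a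
    goes from small to large.  With N = 2 ^ l^2 and a = l^2 + l, N * t ^+ a is at
    most 2 ^- l on [0, 1/2], the point 1/2 included, and still tends to infinity
    on ]1/2, 1]: the l in the exponent makes the bound small at 1/2, and being
    negligible with respect to l^2 it does not spoil the divergence.  The summand
    2 ^- l lifts the values on [0, 1/2] above 1. *)
Definition step l t := (1 - t ^+ (l * l + l)) ^+ (2 ^ (l * l)) + 2^-1 ^+ l.

Let pow_itv t N : 0 <= t <= 1 -> 0 <= t ^+ N <= 1.
Proof. by move=> /andP[t0 t1]; rewrite exprn_ge0// exprn_ile1. Qed.

Lemma step_ge0 l t : 0 <= t <= 1 -> 0 <= step l t.
Proof.
move=> /(@pow_itv t (l * l + l)) /andP[_ t1].
by rewrite addr_ge0// exprn_ge0// subr_ge0.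
Qed.

Lemma step_le l t : 0 <= t <= 1 -> step l t <= 1 + 2^-1 ^+ l.
Proof.
move=> /(@pow_itv t (l * l + l)) /andP[t0 t1].
by rewrite lerD2r exprn_ile1 ?subr_ge0// gerBl.
Qed.

Lemma step_ge1 l t : 0 <= t <= 2^-1 -> 1 <= step l t.
Proof.
move=> /andP[t0 t2].
have t1 : 0 <= t <= 1 by rewrite t0 (le_trans t2)//; lra.
have /andP[_ p1] := @pow_itv t (l * l + l) t1.
rewrite -lerBlDr (le_trans _ (bernoulli_ge _ _ p1))// lerB//.
have p2 : t ^+ (l * l + l) <= 2^-1 ^+ (l * l + l) by rewrite lerXn2r// nnegrE.
apply: le_trans (ler_wpM2l (ler0n _ _) p2) _.
by rewrite exprD mulrA natrX -exprMn divff// expr1n mul1r.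
Qed.

(** Bernoulli bounds the power by 1 / (1 + 2 ^ l^2 * t ^+ (l^2 + l)), and
    2 ^ l^2 * t ^+ (l^2 + l) is the l-th power of (2 t) ^+ l * t, which is
    eventually at least 2. *)
Lemma step_cvg0 t : 2^-1 < t <= 1 -> step ^~ t @ \oo --> 0.
Proof.
move=> /andP[t2 t1]; have t0 : 0 < t by apply: lt_trans t2.
have h2 : (fun l => (2^-1 : R) ^+ l) @ \oo --> 0.
  by apply: cvg_expr; rewrite ger0_norm// invf_lt1// ltr1n.
have ht : (fun l => ((2 * t)^-1) ^+ l) @ \oo --> 0.
  by apply: cvg_expr; rewrite ger0_norm ?invr_ge0 ?invf_lt1; lra.
have t01 : 0 <= t <= 1 by rewrite ltW.
apply: (@squeeze_cvgr _ _ _ _ (fun=> 0) (fun l => 2 * (2^-1 : R) ^+ l)).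
- have : \forall l \near \oo, ((2 * t)^-1) ^+ l < t / 2.
    apply: (cvgr_lt 0 ht); lra.
  apply: filterS => l tl; rewrite step_ge0//=.
  rewrite /step mulrDl mul1r lerD2r.
  have /andP[p0 p1] := @pow_itv t (l * l + l) t01.
  have := bernoulli_le _ (2 ^ (l * l)) (introT andP (conj p0 p1)).
  have N2 : 2 ^+ l <= 1 + (2 ^ (l * l))%:R * t ^+ (l * l + l).
    apply: (@le_trans _ _ (((2 * t) ^+ l * t) ^+ l)).
      rewrite lerXn2r ?nnegrE// ?mulr_ge0 ?exprn_ge0//; try lra.
      have : 0 < (2 * t) ^+ l by rewrite exprn_gt0//; lra.
      move: tl; rewrite exprVn -[X in X < _]mul1r ltr_pdivrMr ?exprn_gt0//; lra.
    by rewrite exprMn -exprM exprMn -mulrA -exprD natrX lerDr.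
  rewrite exprVn -[X in _ -> _ <= X]mul1r => H.
  rewrite ler_pdivlMr ?exprn_gt0// (le_trans _ H)// ler_wpM2l//.
  by rewrite exprn_ge0// subr_ge0.
- exact: cvg_cst.
- by rewrite -[X in _ --> X](mulr0 2); apply: cvgM h2; exact: cvg_cst.
Qed.

Lemma step_cvg t : 0 <= t <= 1 -> step ^~ t @ \oo --> ((t <= 2^-1)%R%:R : R).
Proof.
move=> t01; have /andP[t0 t1] := t01; case: leP => t2 /=.
  apply: (@squeeze_cvgr _ _ _ _ (fun=> 1) (fun l => 1 + (2^-1 : R) ^+ l)).
  - by apply: nearW => l; rewrite step_le// step_ge1// t0.
  - exact: cvg_cst.
  - rewrite -[X in _ --> X]addr0; apply: cvgD; first exact: cvg_cst.
    by apply: cvg_expr; rewrite ger0_norm// invf_lt1// ltr1n.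
by apply: step_cvg0; rewrite t2.
Qed.

End step.

(** * Polynomials close to the indicator of a semialgebraic set *)

Section indicator_approximation.
Context {R : realType} {n m : nat}.
Implicit Type q : mpoly.mpoly n R.

Definition step_mpoly l q : mpoly.mpoly n R :=
  (1 - q ^+ (l * l + l)) ^+ (2 ^ (l * l)) + mpolyC n (2^-1 ^+ l).

Lemma peval_step_mpoly l q x : peval (step_mpoly l q) x = step l (peval q x).
Proof.
by rewrite /peval /step_mpoly /step mevalD mevalC rmorphXn/= mevalB meval1 rmorphXn.
Qed.

(** When |q| <= M on a set, rescale M q takes its values in [0, 1] there, and those
    at most 1/2 are taken exactly where q is nonnegative. *)
Definition rescale (M : R) q : mpoly.mpoly n R := mpolyC n 2^-1 * (1 - M^-1 *: q).

Lemma peval_rescale M q x : peval (rescale M q) x = 2^-1 * (1 - M^-1 * peval q x).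
Proof. by rewrite /peval /rescale mevalM mevalC mevalB meval1 mevalZ. Qed.

Lemma rescale_itv M q x : 0 < M -> `|peval q x| <= M ->
  0 <= peval (rescale M q) x <= 1.
Proof.
move=> M0; rewrite ler_norml peval_rescale => /andP[qM Mq].
have h1 : M^-1 * peval q x <= 1 by rewrite mulrC ler_pdivrMr// mul1r.
have h2 : -1 <= M^-1 * peval q x by rewrite mulrC ler_pdivlMr// mulN1r.
by apply/andP; split; lra.
Qed.

Lemma rescale_le_half M q x : 0 < M ->
  (peval (rescale M q) x <= 2^-1) = (0 <= peval q x).
Proof.
move=> M0; rewrite peval_rescale -[X in _ <= X]mulr1 ler_pM2l ?invr_gt0//.
by rewrite gerBl pmulr_rge0// invr_gt0.
Qed.

(** Since K is the intersection of the sets where g i is nonnegative, its indicator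
    is the product over i of a step function composed with a rescaled g i.
    Replacing each step function by the polynomials [step l] gives polynomials
    that converge pointwise on B, boundedly by 2 ^+ m, so that dominated
    convergence applies. *)
Lemma indicator_approximation (g : 'I_m -> mpoly.mpoly n R) (B : set (n.-tuple R)) :
  let K := basic_closed_semialgebraic g in
  measurable B -> compact_Rn B -> K `<=` B ->
  exists q : nat -> mpoly.mpoly n R,
    [/\ forall l x, K x -> 1 <= peval (q l) x,
        forall l x, B x -> 0 <= peval (q l) x &
        (\int[lebesgue_Rn R n]_(x in B) (peval (q l) x)%:E)%E @[l --> \oo] -->
        lebesgue_Rn R n K].
Proof.
move=> K mB cB KB.
have mK : measurable K := measurable_basic_closed g.
have /choice[M gM] i : exists M : R,
    0 < M /\ forall x, B x -> `|peval (g i) x| <= M.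
  by have [M M0 BM] := peval_bounded _ (g i) cB; exists M.
pose t i := rescale (M i) (g i).
have t01 i x : B x -> 0 <= peval (t i) x <= 1.
  by move=> Bx; have [M0 BM] := gM i; exact: rescale_itv (BM _ Bx).
pose q l := \prod_i step_mpoly l (t i).
have qE l x : peval (q l) x = \prod_i step l (peval (t i) x).
  by rewrite /peval rmorph_prod; apply: eq_bigr => i _; exact: peval_step_mpoly.
have q0 l x : B x -> 0 <= peval (q l) x.
  by move=> Bx; rewrite qE prodr_ge0// => i _; rewrite step_ge0// t01.
have q_cvg x : B x -> peval (q l) x @[l --> \oo] --> (\1_K x : R).
  move=> Bx; under eq_cvg do rewrite qE.
  have -> : \1_K x = \prod_i ((peval (t i) x <= 2^-1)%R%:R : R).
    have [Kx|nKx] := pselect (K x).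
      rewrite indicE mem_set// big1// => i _.
      by have [M0 _] := gM i; rewrite rescale_le_half// Kx.
    rewrite indicE memNset//.
    have /existsNP[i /negP gi] : ~ forall i, 0 <= peval (g i) x by [].
    have [M0 _] := gM i.
    by rewrite (bigD1 i)//= rescale_le_half// (negbTE gi) mul0r.
  apply: cvg_big; first exact: mul_continuous.
  by move=> i _; apply: step_cvg; exact: t01.
exists q; split => //.
- move=> l x Kx; rewrite qE.
  apply: (big_ind (fun y : R => 1 <= y)) => // [y z|i _]; first exact: mulr_ege1.
  have [M0 _] := gM i; apply: step_ge1; rewrite rescale_le_half//.
  by have /andP[-> _] := t01 i x (KB _ Kx); exact: Kx.
rewrite -[X in _ --> lebesgue_Rn R n X](setIidl KB) -integral_indic//.
apply: (@dominated_cvg _ _ _ _ _ mB _ _ (cst (2 ^+ m)%:E)) => //.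
- by move=> l; apply/measurable_EFinP; apply: measurable_funTS; exact: measurable_peval.
- by move=> x Bx; apply: cvg_EFin; [exact: nearW|exact: q_cvg].
- apply/integrableP; split; first exact: measurable_cst.
  rewrite (eq_integral (cst (`|(2 ^+ m)%:E|%E : \bar R)))// integral_cst// abse_EFin.
  by rewrite lte_mul_pinfty ?lee_fin//; exact: lebesgue_Rn_compact_lty.
- move=> l x Bx; rewrite abse_EFin lee_fin ger0_norm ?q0// qE.
  rewrite -[X in 2 ^+ X]card_ord -prodr_const; apply: ler_prod => i _.
  rewrite step_ge0 ?t01//= (le_trans (step_le _ _ (t01 _ _ Bx)))//.
  by rewrite -[leRHS]/(1 + 1) lerD2l exprn_ile1// invf_le1 ?ler1n.
Qed.

End indicator_approximation.

(** * Bounds on the acceptance rate *)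

Lemma uniform_prob_itv {R : realType} (c : R) : 0 <= c <= 1 ->
  uniform_prob (@ltr01 R) `[0, c]%classic = c%:E.
Proof.
move=> /andP[c0 c1]; rewrite /uniform_prob (eq_integral (cst 1%E)); last first.
  move=> x; rewrite inE/= in_itv/= => /andP[x0 xc].
  by rewrite /uniform_pdf x0 (le_trans xc c1) subr0 invr1.
rewrite integral_cst// mul1e. 
apply: etrans (lebesgue_measure_itv `[0, c]) _; rewrite /= lte_fin.
by case: ltP => c0'; rewrite ?sube0//; congr _%:E; apply/le_anti; rewrite c0 c0'.
Qed.

Section acceptance_rate.
Context {R : realType} {n : nat} {K B : set (n.-tuple R)} {p : mpoly.mpoly n R}.
Context {dT : measure_display} {T : measurableType dT} {P : probability T R}.
Context {xi : nat -> {RV P >-> n.-tuple R}} {u : nat -> {RV P >-> R}}.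
Context (mK : measurable K).
Local Open Scope ereal_scope.

Let mprexi k A : measurable A -> measurable (xi k @^-1` A).
Proof. by move=> mA; rewrite -[X in measurable X]setTI; apply: measurable_funPT. Qed.

Let mpreu k A : measurable A -> measurable (u k @^-1` A).
Proof. by move=> mA; rewrite -[X in measurable X]setTI; apply: measurable_funPT. Qed.

Lemma measurable_accepted k : measurable [set w | accepted K p xi u k w].
Proof.
apply: (measurableI (xi k @^-1` K)); first exact: mprexi.
apply: measurable_sublevel; apply: measurable_funM; first exact: measurable_funPT.
by apply: (measurableT_comp (measurable_peval p)); exact: measurable_funPT.
Qed.

Let expected_draws : \int[P]_w num_draws K p xi u w =
  \sum_(0 <= k <oo) P (\bigcap_(j < k) ~` [set w | accepted K p xi u j w]).
Proof.
exact: (integral_first_success P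
  (fun k => [set w | accepted K p xi u k w]) measurable_accepted).
Qed.

(** At least one sample is drawn. *)
Lemma acceptance_rate_le1 : acceptance_rate K p xi u <= 1.
Proof.
rewrite /acceptance_rate expected_draws inve_ple ?inE/= ?nneseries_ge0// inve1.
apply: le_trans (nneseries_lim_ge 1 _) => //.
by rewrite big_nat1 bigcap_mkord big_ord0 probability_setT.
Qed.

(** Samples xi in K' and u in [0, c] are accepted.  These sub-events are rectangles
    in (xi, u), so their joint law is given by independence alone, without
    integrating the acceptance probability 1 / p over K.  The number of draws is
    thus stochastically dominated by a geometric one of parameter a * c. *)
Lemma acceptance_rate_ge (K' : set (n.-tuple R)) (a c : R) :
  sampling_run B p xi u -> measurable K' ->
  (0 < a)%R -> (0 < c <= 1)%R ->
  (forall k, distribution P (xi k) K' = a%:E) ->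
  (forall x, K' x -> K x /\ (0 <= peval p x <= c^-1)%R) ->
  (a * c)%:E <= acceptance_rate K p xi u.
Proof.
move=> [_ uU ind] mK' a0 /andP[c0 c1] Pa K'K.
pose Z i := match i with
  | inl k => xi k @^-1` K' | inr k => u k @^-1` `[0%R, c]%classic end.
have mZ i : measurable (Z i).
  by case: i => k; [exact: mprexi|apply: mpreu; exact: measurable_itv].
have PZr k : P (Z (inr k)) = c%:E.
  by rewrite -uniform_prob_itv ?(ltW c0)// -(uU k).
have indZ (J : {fset nat + nat}) :
    P (\bigcap_(i in [set` J]) Z i) = \prod_(i <- J) P (Z i).
  apply: ind => -[] i _ /=.
    by exists K' => //; rewrite setTI.
  by exists `[0%R, c]%classic; [exact: measurable_itv|rewrite setTI].
have noZ := prob_no_joint_success P Z a c mZ indZ Pa PZr.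
have a1 : (a <= 1)%R.
  by rewrite -lee_fin -(Pa 0%N) probability_le1//; exact: (mZ (inl 0%N)).
have ac0 : (0 < a * c)%R by rewrite mulr_gt0.
have ac1 : (a * c <= 1)%R by rewrite mulr_ile1// ltW.
rewrite /acceptance_rate expected_draws inve_pge ?inE/= ?nneseries_ge0//; last first.
  by rewrite lee_fin ltW.
rewrite inver gt_eqF//.
have -> : ((a * c)^-1 = (1 - (1 - a * c))^-1)%R by rewrite opprB addrC subrK.
rewrite -nneseries_geometric; last by rewrite subr_ge0 ac1/= ltrBlDr ltrDl.
apply: lee_nneseries => // k _.
rewrite -noZ.
apply: le_measure; rewrite ?inE.
- by apply: measurable_no_success => j; exact: measurable_accepted.
- apply: (@measurable_no_success _ _ (fun j => Z (inl j) `&` Z (inr j))) => j.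
  exact: measurableI.
move=> w noacc j jk [/= /K'K[Kx /andP[p0 pc]]]; rewrite in_itv/= => /andP[u0 uc].
apply: (noacc j jk); split => //.
by rewrite -(divff (lt0r_neq0 c0)) ler_pM.
Qed.

End acceptance_rate.

(** * Convergence *)

Section rate_bounds.
Local Open Scope ereal_scope.

(** A fixed polynomial with the required bounds on K and B is feasible in every
    degree above its own, hence bounds all later optimal values. *)
Lemma optimal_value_le {R : realType} {n m : nat} (g : 'I_m -> mpoly.mpoly n R)
    (B : set (n.-tuple R)) (p : nat -> mpoly.mpoly n R) (e : R) :
  let K := basic_closed_semialgebraic g in
  measurable B -> compact_Rn B -> K `<=` B -> lebesgue_Rn R n K \is a fin_num ->
  (forall d, (0 < d)%N -> optimal K B d (p d)) -> (0 < e)%R ->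
  \forall d \near \oo,
    \int[lebesgue_Rn R n]_(x in B) (peval (p d) x)%:E <= lebesgue_Rn R n K + e%:E.
Proof.
move=> K mB cB KB Kfin popt e0.
have [q [q1 q0 q_cvg]] := indicator_approximation g B mB cB KB.
have KKe : lebesgue_Rn R n K < lebesgue_Rn R n K + e%:E by rewrite lteDl.
have [l _ /(_ l (leqnn l)) /= ql] := q_cvg _ (open_ereal_lt' KKe).
near=> d.
have d0 : (0 < d)%N by near: d; exact: nbhs_infty_gt.
apply: le_trans (ltW ql).
apply: (popt d d0).2; split; [|exact: q1|exact: q0].
by apply: (@leq_trans d) => //; near: d; exact: nbhs_infty_ge.
Unshelve. all: by end_near. Qed.

(** If f >= 1 has an integral over K close to mu K, then f is close to 1 on most of
    K: the integral is at least mu K + e * mu (K `&` [set x | f x > 1 + e]), so the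
    exceptional part has measure at most v * e. *)
Lemma measure_near1_ge {d : measure_display} {T : measurableType d} {R : realType}
    (mu : {measure set T -> \bar R}) (K : set T) (f : T -> R) (v e : R) :
  measurable K -> measurable_fun setT f -> (forall x, K x -> (1 <= f x)%R) ->
  mu K = v%:E -> (0 < e)%R ->
  \int[mu]_(x in K) (f x)%:E <= (v * (1 + e ^+ 2))%:E ->
  (v * (1 - e))%:E <= mu (K `&` [set x | (f x <= 1 + e)%R]).
Proof.
move=> mK mf f1 Kv e0 fK; set K' := K `&` _.
have mK' : measurable K'.
  by apply: measurableI => //; exact: measurable_sublevel.
have mD : measurable (K `\` K') by exact: measurableD.
have KE : K = K' `|` (K `\` K') by rewrite setDUK// => x [].
have KD : [disjoint K' & K `\` K'].
  by apply/disj_setPS => x [K'x [_]].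
have vE : v%:E = mu K' + mu (K `\` K').
  rewrite -Kv {1}KE measureU//; exact/eqP.
have fin A : measurable A -> A `<=` K -> mu A \is a fin_num.
  move=> mA AK; rewrite ge0_fin_numE// (@le_lt_trans _ _ (mu K)) ?Kv ?ltry//.
  by rewrite -Kv le_measure// inE.
have finK' : mu K' \is a fin_num by apply: fin => // x [].
have finD : mu (K `\` K') \is a fin_num by apply: fin => // x [].
have mEf A : measurable_fun A (fun x => (f x)%:E).
  by apply/measurable_EFinP; exact: measurable_funTS.
have f0 x : K x -> 0 <= (f x)%:E.
  by move=> Kx; rewrite lee_fin (le_trans ler01)// f1.
have h : mu K' + (1 + e)%:E * mu (K `\` K') <= (v * (1 + e ^+ 2))%:E.
  apply: le_trans fK; rewrite [in leRHS]KE ge0_integral_setU//; last first.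
    by rewrite -KE.
  rewrite leeD//.
    rewrite -[leLHS]mul1e -integral_cst//; apply: ge0_le_integral => //.
    by move=> x [Kx _]; rewrite lee_fin f1.
  rewrite -integral_cst//; apply: ge0_le_integral => //.
  - by move=> x _; rewrite lee_fin addr_ge0// ltW.
  - move=> x [Kx nK'x]; rewrite lee_fin leNgt; apply/negP => /ltW fx.
    by apply: nK'x.
move: vE h; rewrite -(fineK finK') -(fineK finD) -EFinM -!EFinD => -[vE].
rewrite !lee_fin; set x := fine _ in vE *; set y := fine _ in vE *.
move=> h; have ey : (e * y <= e * (v * e))%R by rewrite expr2 in h; lra.
by rewrite ler_pM2l// in ey; lra.
Qed.

(** The part K' of K where p <= 1 + e has probability at least
    (1 - e) / (1 + e ^+ 2) under the density proportional to p, and there u is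
    small enough with probability 1 / (1 + e). *)
Lemma acceptance_rate_ge_optimal {R : realType} {n : nat} (K B : set (n.-tuple R))
    (p : mpoly.mpoly n R) (v e : R) {dT : measure_display} {T : measurableType dT}
    (P : probability T R) (xi : nat -> {RV P >-> n.-tuple R})
    (u : nat -> {RV P >-> R}) :
  measurable K -> measurable B -> K `<=` B ->
  (forall x, K x -> (1 <= peval p x)%R) -> (forall x, B x -> (0 <= peval p x)%R) ->
  lebesgue_Rn R n K = v%:E -> (0 < v)%R -> (0 < e < 1)%R ->
  \int[lebesgue_Rn R n]_(x in B) (peval p x)%:E <= (v * (1 + e ^+ 2))%:E ->
  sampling_run B p xi u ->
  (1 - 3 * e)%:E <= acceptance_rate K p xi u.
Proof.
move=> mK mB KB p1 p0 Kv v0 /andP[e0 e1] pB run.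
have mp A : measurable_fun A (fun x => (peval p x)%:E).
  by apply/measurable_EFinP; apply: measurable_funTS; exact: measurable_peval.
set W := \int[_]_(x in B) _ in pB.
have p0E x : B x -> 0 <= (peval p x)%:E by move=> Bx; rewrite lee_fin p0.
have le1 A : measurable A -> A `<=` K ->
    lebesgue_Rn R n A <= \int[lebesgue_Rn R n]_(x in A) (peval p x)%:E.
  move=> mA AK; rewrite -[leLHS]mul1e -integral_cst//; apply: ge0_le_integral => //.
  by move=> x Ax; rewrite lee_fin p1//; exact: AK.
have KW : \int[lebesgue_Rn R n]_(x in K) (peval p x)%:E <= W.
  exact: ge0_subset_integral.
have vW : v%:E <= W by rewrite -Kv (le_trans _ KW)// le1.
have Wfin : W \is a fin_num.
  by rewrite ge0_fin_numE ?integral_ge0// (le_lt_trans pB)// ltry.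
have W0 : (0 < fine W)%R by rewrite (lt_le_trans v0)// -lee_fin fineK.
have W2 : (fine W <= v * (1 + e ^+ 2))%R by rewrite -lee_fin fineK.
pose K' := K `&` [set x | (peval p x <= 1 + e)%R].
have mK' : measurable K'.
  by apply: measurableI => //; apply: measurable_sublevel; exact: measurable_peval.
have K'v : (v * (1 - e))%:E <= lebesgue_Rn R n K'.
  by apply: measure_near1_ge => //; [exact: measurable_peval|exact: le_trans KW pB].
set I := \int[lebesgue_Rn R n]_(x in K') (peval p x)%:E.
have I1 : (v * (1 - e))%:E <= I by rewrite (le_trans K'v)// le1// => x [].
have Ifin : I \is a fin_num.
  rewrite ge0_fin_numE; last by rewrite (le_trans _ I1)// lee_fin mulr_ge0//; lra.
  rewrite (@le_lt_trans _ _ W) ?ltey_eq ?Wfin//; apply: ge0_subset_integral => //.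
  by move=> x [/KB].
have I1' : (v * (1 - e) <= fine I)%R by rewrite -lee_fin fineK.
have distK' k : distribution P (xi k) K' = (fine I / fine W)%:E.
  have [dens _ _] := run; rewrite dens// setIidl; last by move=> x [/KB].
  by rewrite -/I -/W -(fineK Ifin) -(fineK Wfin) inver gt_eqF.
(* The numerator is at least v * (1 - e), the denominator at most v * (1 + e ^+ 2). *)
have aI : ((1 - e) / (1 + e ^+ 2) <= fine I / fine W)%R.
  have e2 : (0 < 1 + e ^+ 2)%R by rewrite ltr_wpDr// sqr_ge0.
  rewrite ler_pdivrMr// mulrAC ler_pdivlMr//.
  apply: (@le_trans _ _ ((1 - e) * (v * (1 + e ^+ 2))))%R.
    by rewrite ler_wpM2l//; lra.
  by rewrite mulrA (mulrC _ v) ler_wpM2r// ltW.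
have rate : ((fine I / fine W) * (1 + e)^-1)%:E <= acceptance_rate K p xi u.
  apply: (@acceptance_rate_ge _ _ K B p _ _ P xi u mK K') => //.
  - by rewrite divr_gt0// (lt_le_trans _ I1')// mulr_gt0//; lra.
  - by rewrite invr_gt0 invf_le1; lra.
  - move=> x [Kx px]; split => //; rewrite invrK p0//; exact: KB.
apply: le_trans rate; rewrite lee_fin.
apply: le_trans (ler_wpM2r _ aI); last by rewrite invr_ge0; lra.
rewrite -mulrA -invfM ler_pdivlMr; last first.
  by rewrite mulr_gt0//; [rewrite ltr_wpDr// sqr_ge0|lra].
rewrite expr2; nra.
Qed.

End rate_bounds.

Theorem corollary1 (R : realType) (n m : nat)
  (g : 'I_m -> mpoly.mpoly n R) (Bi : 'I_n -> set R)
  (K B : set (n.-tuple R))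
  (K_def : K = basic_closed_semialgebraic g) (B_def : B = box Bi)
  (K_compact : compact_Rn K)
  (K_interior : interior_Rn K !=set0)
  (B_compact : compact_Rn B)
  (B_semialgebraic : semialgebraic B)
  (KB : K `<=` B)
  (p : nat -> mpoly.mpoly n R)
  (p_optimal : forall d : nat, (0 < d)%N -> optimal K B d (p d))
  (dT : nat -> measure_display) (T : forall d : nat, measurableType (dT d))
  (P : forall d : nat, probability (T d) R)
  (xi : forall d : nat, nat -> {RV (P d) >-> n.-tuple R})
  (u : forall d : nat, nat -> {RV (P d) >-> R})
  (run : forall d : nat, (0 < d)%N -> sampling_run B (p d) (xi d) (u d)) :
  (fun d : nat => acceptance_rate K (p d) (xi d) (u d)) @ \oo --> (1 : R)%:E.
Proof.
have mK : measurable K by rewrite K_def; exact: measurable_basic_closed.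
have mB : measurable B by exact: measurable_semialgebraic.
have Kfin : lebesgue_Rn R n K \is a fin_num.
  rewrite ge0_fin_numE// (le_lt_trans _ (lebesgue_Rn_compact_lty B mB B_compact))//.
  by rewrite le_measure// inE.
set v := fine (lebesgue_Rn R n K).
have Kv : lebesgue_Rn R n K = v%:E by rewrite fineK.
have v0 : 0 < v by rewrite -lte_fin fineK// lebesgue_Rn_interior_gt0.
have rate_ge e : 0 < e < 1 -> \forall d \near \oo,
    ((1 - 3 * e)%:E <= acceptance_rate K (p d) (xi d) (u d))%E.
  move=> /andP[e0 e1]; rewrite K_def in Kfin Kv p_optimal KB *.
  have ve0 : 0 < v * e ^+ 2 by rewrite mulr_gt0// exprn_gt0.
  near=> d.
  have d0 : (0 < d)%N by near: d; exact: nbhs_infty_gt.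
  have [[_ p1 p0] _] := p_optimal d d0.
  apply: (acceptance_rate_ge_optimal _ B (p d) v) => //.
  - exact: measurable_basic_closed.
  - by rewrite e0.
  - rewrite mulrDr mulr1 EFinD -Kv; near: d.
    exact: (optimal_value_le g B p _ mB B_compact KB Kfin p_optimal).
  - exact: run.
have rate_le d : (acceptance_rate K (p d) (xi d) (u d) <= 1)%E.
  exact: acceptance_rate_le1.
have rate_ge0 d : (0 <= acceptance_rate K (p d) (xi d) (u d))%E.
  by rewrite inve_ge0 integral_ge0// => w _; apply: le_ereal_inf_tmp => _ [k _ <-].
have rate_fin d : acceptance_rate K (p d) (xi d) (u d) \is a fin_num.
  by rewrite ge0_fin_numE// (le_lt_trans (rate_le d)) ?ltry.
apply: cvg_EFin; first exact: nearW.
apply/cvgrPdist_le => e e0; near=> d.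
have r1 : fine (acceptance_rate K (p d) (xi d) (u d)) <= 1 by rewrite -lee_fin fineK.
rewrite /= ger0_norm ?subr_ge0// lerBlDl addrC -lerBlDl -lee_fin fineK//.
(* The bound 1 - 3 * e' needs e' < 1, whatever the tolerance e. *)
pose e' := Num.min (e / 3) (1 / 2).
apply: (@le_trans _ _ (1 - 3 * e')%:E).
  by rewrite lee_fin lerB// mulrC -ler_pdivlMr// ge_min lexx.
near: d; apply: rate_ge.
by rewrite lt_min gt_min; apply/andP; split; [apply/andP; split|apply/orP; right]; lra.
Unshelve. all: by end_near. Qed.
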